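(* Let $q\in\mathbb{C}$ with $0<|q|<1$, let $n\ge 0$ be an integer, let $a,b$ be positive integers with $a\equiv 1\pmod 2$ and $b\equiv 1\pmod 2$, and let $x\in\mathbb{C}$. Then $$[2]_{q^b}\sum_{i=0}^{n}\binom{n}{i}[a]_q^{n-i}[b]_q^i\,E_{n-i,q^a}(bx)\,S_{n,i,q^b}^{*}(a)=[2]_{q^a}\sum_{i=0}^{n}\binom{n}{i}[b]_q^{n-i}[a]_q^i\,E_{n-i,q^b}(ax)\,S_{n,i,q^a}^{*}(b),$$ where, for a base $p$ (here $p=q^a$ or $p=q^b$) and a positive integer $k$, $S_{n,i,p}^{*}(k)=\sum_{j=0}^{k-1}(-1)^jp^{(n+1-i)j}[j]_p^i$.
   Context: Fix $\lambda\in\mathbb{C}$ with $e^{\lambda}=q$, and for $y\in\mathbb{C}$ put $q^y=e^{\lambda y}$. For a positive integer $c$, powers of the base $q^c$ are $(q^c)^y=q^{cy}=e^{c\lambda y}$. The $q$-analogue of $y\in\mathbb{C}$ is $[y]_q=\frac{1-q^y}{1-q}$, and for the base $q^c$ it is $[y]_{q^c}=\frac{1-q^{cy}}{1-q^c}$; in particular $[2]_{q^c}=1+q^c$. The $q$-Euler polynomials $E_{n,q}(y)$, $n\ge 0$, are defined by the generating function $$[2]_q\sum_{m=0}^{\infty}(-1)^mq^m e^{[m+y]_q t}=\sum_{n=0}^{\infty}E_{n,q}(y)\frac{t^n}{n!},$$ and $E_{n,q^c}(y)$ denotes the same object with $q$ replaced by $q^c$ throughout (using $(q^c)^y=q^{cy}$).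 The convention $0^0=1$ is used. *)

(* Defs.v *)
From Stdlib Require Import Reals Factorial ClassicalEpsilon.
From Coquelicot Require Import Coquelicot.

Open Scope C_scope.

Definition Cexp (z : C) : C := (exp (Re z) * cos (Im z), exp (Re z) * sin (Im z))%R.

Definition NtoC (k : nat) : C := RtoC (INR k).

(* A base is given by two arguments: its value p and the chosen logarithm mu
   with Cexp mu = p, which fixes the powers p^y := Cexp (mu * y).  The base q^c
   is passed as p := q ^ c and mu := c * lam, where Cexp lam = q. *)

Definition qnum (p mu y : C) : C := (1 - Cexp (mu * y)) / (1 - p).

Definition qEuler_genfun (p mu y : C) (E : nat -> C) : Prop :=
  forall t : C, exists s : C,
    is_series (fun m : nat =>
      RtoC (-1) ^ m * p ^ m * Cexp (qnum p mu (NtoC m + y) * t)) s /\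
    is_series (fun n : nat => E n * (t ^ n / NtoC (fact n))) (qnum p mu 2 * s).

(* E_{n,p}(y): for 0 < |p| < 1 both series of [qEuler_genfun] converge for every
   t, so the selected sequence exists and is unique (coefficients of an entire
   function of t). *)
Definition qEuler (p mu : C) (n : nat) (y : C) : C :=
  epsilon (inhabits (fun _ : nat => RtoC 0)) (qEuler_genfun p mu y) n.

(* [sum_n f m] has m + 1 terms, so the index j below runs over 0, ..., k - 1
   when k > 0. *)
Definition Sstar (p mu : C) (n i k : nat) : C :=
  sum_n (fun j : nat =>
    RtoC (-1) ^ j * p ^ ((n + 1 - i) * j) * qnum p mu (NtoC j) ^ i) (k - 1).

(* Main.v *)
(** Interchanging the two summations in the generating function gives
    [E_{n,p}(y) = [2]_p * sum_m (-1)^m p^m [m+y]_p^n].  With [[a]_q [m+bx]_{q^a} =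
    [am+abx]_q] and [[b]_q [j]_{q^b} = [bj]_q], the binomial theorem turns the left-hand
    side into [[2]_{q^a} [2]_{q^b} sum_m sum_{j<a} (-1)^(m+j) F(am+bj)] with
    [F(k) = q^k [k+abx]_q^n].  This double sum is symmetric in [a] and [b]: [F] is a
    linear combination of geometric sequences [r^k], and for these it equals
    [(1 + r^(ab)) / ((1 + r^a) (1 + r^b))] when [a] is odd. *)

Require Import Defs.
From Stdlib Require Import Reals Factorial Lra Lia ClassicalEpsilon.
From Coquelicot Require Import Coquelicot.

Open Scope C_scope.

(* Pins an equation whose type is displayed as [AbelianMonoid.sort _] to [C]. *)
Ltac ring_C := lazymatch goal with |- ?a = ?b => change (a = b :> C) end; ring.

(** * Series of complex numbers *)

Lemma is_series_Cmod (a : nat -> C) (l : C) :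
  is_series a l <->
  forall eps : R, (0 < eps)%R ->
    exists N, forall n, (N <= n)%nat -> (Cmod (sum_n a n - l) < eps)%R.
Proof.
  unfold is_series; split.
  - intros H eps Heps.
    exact (proj1 (filterlim_locally_ball_norm (sum_n a) l) H (mkposreal eps Heps)).
  - intros H; apply (filterlim_locally_ball_norm (sum_n a) l); intros eps.
    exact (H eps (cond_pos eps)).
Qed.

Lemma is_series_C_unique (a : nat -> C) (l l' : C) :
  is_series a l -> is_series a l' -> l = l'.
Proof. exact (filterlim_locally_unique (V := C_NormedModule) (sum_n a) l l'). Qed.

(** This and the next few facts are generic ones restated with the concrete operations of [C], so
    that [rewrite] and [ring] meet [Cplus] and [Cmult] rather than projections of algebraic
    structures. *)
Lemma sum_n_C_S (a : nat -> C) (n : nat) : sum_n a (S n) = sum_n a n + a (S n) :> C.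
Proof. exact (sum_Sn (G := C_AbelianMonoid) a n). Qed.

Lemma sum_n_C_O (a : nat -> C) : sum_n a 0 = a 0%nat :> C.
Proof. exact (sum_O (G := C_AbelianMonoid) a). Qed.

Lemma sum_n_C_mult_l (c : C) (a : nat -> C) (n : nat) :
  sum_n (fun k => c * a k) n = c * sum_n a n :> C.
Proof. exact (sum_n_mult_l (K := C_Ring) c a n). Qed.

Lemma sum_n_C_plus (a b : nat -> C) (n : nat) :
  sum_n (fun k => a k + b k) n = sum_n a n + sum_n b n :> C.
Proof. exact (sum_n_plus (G := C_AbelianMonoid) a b n). Qed.

Lemma is_series_C_plus (a b : nat -> C) (la lb : C) :
  is_series a la -> is_series b lb -> is_series (fun n => a n + b n) (la + lb).
Proof. exact (is_series_plus (V := C_NormedModule) a b la lb). Qed.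

Lemma is_series_C_scal (c : C) (a : nat -> C) (l : C) :
  is_series a l -> is_series (fun n => c * a n) (c * l).
Proof. exact (is_series_scal (V := C_NormedModule) c a l). Qed.

Lemma is_series_C_sum_n (f : nat -> nat -> C) (l : nat -> C) (N : nat) :
  (forall i, (i <= N)%nat -> is_series (f i) (l i)) ->
  is_series (fun m => sum_n (fun i => f i m) N) (sum_n l N).
Proof.
  induction N as [|N IH]; intros H.
  - rewrite sum_n_C_O.
    apply is_series_ext with (f 0%nat); [intros m; now rewrite sum_n_C_O | now apply H].
  - rewrite sum_n_C_S.
    apply is_series_ext with (fun m => sum_n (fun i => f i m) N + f (S N) m).
    + intros m; now rewrite sum_n_C_S.
    + apply is_series_C_plus; [apply IH; intros i Hi; apply H; lia | apply H; lia].
Qed.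

Lemma Re_sum_n (a : nat -> C) (n : nat) : Re (sum_n a n) = sum_n (fun k => Re (a k)) n.
Proof.
  induction n as [|n IH]; [now rewrite sum_n_C_O, sum_O|].
  now rewrite sum_n_C_S, sum_Sn, <- IH.
Qed.

Lemma is_series_C_Re (a : nat -> C) (l : C) :
  is_series a l -> is_series (fun n => Re (a n)) (Re l).
Proof.
  intros H; apply is_series_Reals; intros eps Heps.
  destruct (proj1 (is_series_Cmod a l) H eps Heps) as [N HN].
  exists N; intros n Hn; specialize (HN n Hn).
  rewrite <- sum_n_Reals, <- Re_sum_n; unfold Rdist.
  eapply Rle_lt_trans; [|exact HN].
  apply (re_le_Cmod (sum_n a n - l)).
Qed.

(** Lets any bound or identity for [Re (w * z)] with arbitrary [w] serve for the imaginary part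
    too. *)
Lemma Im_as_Re (z : C) : Im z = Re (- Ci * z).
Proof. destruct z as [u v]; simpl; ring. Qed.

Lemma C1_minus_neq_0 (p : C) : (Cmod p < 1)%R -> 1 - p <> 0.
Proof.
  intros Hp E; assert (p = 1) by (replace p with (1 - (1 - p)) by ring; rewrite E; ring).
  subst p; rewrite Cmod_1 in Hp; lra.
Qed.

Lemma is_series_C_geom (r : C) : (Cmod r < 1)%R -> is_series (fun n => r ^ n) (/ (1 - r)).
Proof.
  intros Hr.
  pose proof (C1_minus_neq_0 r Hr) as Hr1.
  assert (Hs : forall n, sum_n (fun k => r ^ k) n = (1 - r ^ S n) / (1 - r) :> C).
  { induction n as [|n IH].
    - rewrite sum_n_C_O; simpl; field; auto.
    - rewrite sum_n_C_S, IH, !Cpow_S; field; auto. }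
  apply is_series_Cmod; intros eps Heps.
  assert (Hm : (0 < Cmod (1 - r))%R) by now apply Cmod_gt_0.
  destruct (pow_lt_1_zero (Cmod r)) with (y := (eps * Cmod (1 - r))%R) as [N HN].
  - now rewrite Rabs_pos_eq by apply Cmod_ge_0.
  - apply Rmult_lt_0_compat; auto.
  - exists N; intros n Hn; rewrite Hs.
    replace ((1 - r ^ S n) / (1 - r) - / (1 - r)) with (- (r ^ S n / (1 - r))) by (field; auto).
    rewrite Cmod_opp, Cmod_div, Cmod_pow by auto.
    specialize (HN (S n) ltac:(lia)).
    rewrite Rabs_pos_eq in HN by apply pow_le, Cmod_ge_0.
    apply Rmult_lt_reg_r with (Cmod (1 - r)); auto.
    unfold Rdiv; rewrite Rmult_assoc, Rinv_l, Rmult_1_r by lra; exact HN.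
Qed.

Lemma ex_series_C_le (a : nat -> C) (b : nat -> R) :
  (forall n, (Cmod (a n) <= b n)%R) -> ex_series b -> exists l : C, is_series a l.
Proof. exact (ex_series_le (V := C_CompleteNormedModule) a b). Qed.

Lemma sum_n_C_le (a : nat -> C) (b : nat -> R) (n : nat) :
  (forall k, (Cmod (a k) <= b k)%R) -> (Cmod (sum_n a n) <= sum_n b n)%R.
Proof.
  intros H; induction n as [|n IH].
  - rewrite sum_n_C_O, sum_O; apply H.
  - rewrite sum_n_C_S, sum_Sn; change plus with Rplus.
    eapply Rle_trans; [apply Cmod_triangle|]; apply Rplus_le_compat; auto.
Qed.

Lemma is_series_C_le (a : nat -> C) (b : nat -> R) (la : C) (lb : R) :
  (forall n, (Cmod (a n) <= b n)%R) -> is_series a la -> is_series b lb ->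
  (Cmod la <= lb)%R.
Proof.
  intros H Ha Hb; apply le_epsilon; intros eps Heps.
  destruct (proj1 (is_series_Cmod a la) Ha (eps / 2)%R ltac:(lra)) as [N1 H1].
  apply is_series_Reals in Hb.
  destruct (Hb (eps / 2)%R ltac:(lra)) as [N2 H2].
  set (n := max N1 N2).
  specialize (H1 n ltac:(lia)); specialize (H2 n ltac:(lia)).
  rewrite <- sum_n_Reals in H2; unfold Rdist in H2; apply Rabs_lt_between in H2.
  pose proof (sum_n_C_le a b n H) as H3.
  assert (H4 : (Cmod la <= Cmod (sum_n a n) + Cmod (sum_n a n - la))%R).
  { rewrite <- (Cmod_opp (sum_n a n - la)).
    replace la with (sum_n a n + - (sum_n a n - la)) at 1 by ring.
    apply Cmod_triangle. }
  lra.
Qed.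

(** * Uniqueness of power series coefficients *)

Lemma pseries_zero_coef (a : nat -> R) :
  (forall t : R, is_series (fun n => a n * t ^ n)%R 0%R) -> forall n, a n = 0%R.
Proof.
  intros H n.
  assert (Hp : forall t : R, is_pseries a t 0%R).
  { intros t; apply is_series_ext with (2 := H t).
    intros k; rewrite <- (pow_n_pow t k); exact (Rmult_comm _ _). }
  apply (PSeries_ext_recip a (fun _ => 0%R) n).
  (* Outside the disk of convergence the terms do not tend to 0, so convergence at [t = 1] already
     forces a radius of at least 1. *)
  - apply Rbar_lt_le_trans with (Finite 1); [simpl; lra|].
    apply Rbar_not_lt_le; intros Hlt.
    apply (CV_disk_outside a 1); [now rewrite Rabs_R1|].
    apply ex_series_lim_0; eexists; apply H.
  - rewrite CV_radius_const_0; exact I.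
  - apply filter_forall; intros t.
    rewrite PSeries_const_0; apply is_pseries_unique, Hp.
Qed.

(** Reduction to real power series: for real [t] and fixed [w], the numbers
    [Re (w * (E k - E' k)) / k!] are the coefficients of a real series with sum 0. The choices
    [w = 1] and [w = - Ci] recover both parts of [E n - E' n]. *)
Lemma C_pseries_unique (E E' : nat -> C) :
  (forall t : C, exists l : C,
     is_series (fun n => E n * (t ^ n / NtoC (fact n))) l /\
     is_series (fun n => E' n * (t ^ n / NtoC (fact n))) l) ->
  forall n, E n = E' n.
Proof.
  intros H n.
  assert (Hre : forall w : C, Re (w * (E n - E' n)) = 0%R).
  { intros w.
    pose (a := fun k => (Re (w * (E k - E' k)) / INR (fact k))%R).
    assert (Ha : a n = 0%R).
    { apply pseries_zero_coef; intros t.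
      destruct (H (RtoC t)) as [l [H1 H2]].
      assert (H3 := is_series_C_scal w _ _
                (is_series_C_plus _ _ _ _ H1 (is_series_C_scal (-(1)) _ _ H2))).
      replace (w * (l + - (1) * l)) with (RtoC 0) in H3 by ring.
      apply is_series_C_Re in H3.
      revert H3; apply is_series_ext; intros k.
      unfold a, NtoC.
      pose proof (INR_fact_neq_0 k) as Hk.
      rewrite <- RtoC_pow, <- RtoC_div by auto.
      set (c := (t ^ k / INR (fact k))%R).
      replace (w * (E k * c + - (1) * (E' k * c))) with (w * (E k - E' k) * c) by ring.
      refine (eq_trans (A := R) (y := (Re (w * (E k - E' k)) * c)%R) _ _).
      - simpl; ring.
      - unfold c; field; auto. }
    unfold a in Ha.
    pose proof (INR_fact_neq_0 n) as Hk.
    rewrite <- (Rmult_0_l (INR (fact n))), <- Ha; field; auto. }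
  assert (H0 : E n - E' n = 0).
  { apply injective_projections.
    - change (Re (E n - E' n) = 0%R).
      rewrite <- (Hre 1); f_equal; ring.
    - change (Im (E n - E' n) = 0%R); rewrite Im_as_Re; apply Hre. }
  replace (E n) with ((E n - E' n) + E' n) by ring; rewrite H0; ring.
Qed.

(** * The complex exponential and its Taylor remainder *)

Lemma Cexp_0 : Cexp 0 = 1.
Proof. unfold Cexp; simpl; rewrite exp_0, cos_0, sin_0; apply injective_projections; simpl; ring. Qed.

Lemma Cexp_plus (z w : C) : Cexp (z + w) = Cexp z * Cexp w.
Proof.
  destruct z as [u v], w as [u' v']; unfold Cexp; simpl.
  rewrite exp_plus, cos_plus, sin_plus; apply injective_projections; simpl; ring.
Qed.

Lemma Cexp_NtoC_mult (k : nat) (z : C) : Cexp (NtoC k * z) = Cexp z ^ k.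
Proof.
  induction k as [|k IH].
  - unfold NtoC; simpl; replace (0 * z) with (RtoC 0) by ring; apply Cexp_0.
  - unfold NtoC in *; rewrite S_INR, RtoC_plus, Cpow_S, <- IH, <- Cexp_plus; f_equal; ring.
Qed.

Lemma Cmod_Cexp (z : C) : Cmod (Cexp z) = exp (Re z).
Proof.
  unfold Cexp, Cmod; simpl fst; simpl snd.
  replace ((exp (Re z) * cos (Im z)) ^ 2 + (exp (Re z) * sin (Im z)) ^ 2)%R
    with (Rsqr (exp (Re z)))%R.
  - apply sqrt_Rsqr; left; apply exp_pos.
  - pose proof (sin2_cos2 (Im z)) as E; unfold Rsqr in *.
    transitivity (exp (Re z) * exp (Re z) * (sin (Im z) * sin (Im z) + cos (Im z) * cos (Im z)))%R;
      [rewrite E|]; ring.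
Qed.

(** The free factor [w] makes the family closed under differentiation, which replaces [w] by
    [w * z]; higher derivatives then follow by induction. *)
Lemma is_derive_Re_Cexp (w z : C) (s : R) :
  is_derive (fun s : R => Re (w * Cexp (s * z))) s (Re (w * z * Cexp (s * z))).
Proof.
  destruct w as [w1 w2], z as [u v].
  assert (E : forall t : R, Cexp (t * (u, v))
                = (exp (t * u) * cos (t * v), exp (t * u) * sin (t * v))%R).
  { intros t; unfold Cexp; simpl.
    now rewrite !Rmult_0_l, Rminus_0_r, Rplus_0_r. }
  rewrite E.
  apply is_derive_ext with
    (fun t => w1 * (exp (t * u) * cos (t * v)) - w2 * (exp (t * u) * sin (t * v)))%R.
  - intros t; now rewrite E.
  - simpl; auto_derive; auto; ring.
Qed.

Lemma is_derive_n_Re_Cexp (w z : C) (k : nat) (s : R) :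
  is_derive_n (fun s : R => Re (w * Cexp (s * z))) k s (Re (w * z ^ k * Cexp (s * z))).
Proof.
  revert s; induction k as [|k IH]; intros s.
  - now replace (w * z ^ 0) with w by (simpl; ring).
  - apply is_derive_ext with (fun s : R => Re (w * z ^ k * Cexp (s * z))).
    + intros t; symmetry; apply is_derive_n_unique, IH.
    + replace (w * z ^ S k) with (w * z ^ k * z) by (rewrite Cpow_S; ring).
      apply is_derive_Re_Cexp.
Qed.

Definition Cexp_partial (N : nat) (z : C) : C := sum_n (fun k => z ^ k / NtoC (fact k)) N.

(** The Lagrange remainder is a statement about real functions, so it is applied on [[0, 1]] to
    [s -> Re (w * Cexp (s * z))]; [w] is kept free to reach both real and imaginary parts. *)
Lemma Re_Cexp_Taylor (w z : C) (N : nat) :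
  (Rabs (Re (w * (Cexp z - Cexp_partial N z)))
   <= Cmod w * (Cmod z ^ S N / INR (fact (S N)) * exp (Cmod z)))%R.
Proof.
  destruct (Taylor_Lagrange (fun s : R => Re (w * Cexp (s * z))) N 0 1) as [zeta [Hz E]].
  - lra.
  (* [ex_derive_n] of order 0 is [True] by definition. *)
  - intros t _ [|k] _; [exact I|]. eexists; apply (is_derive_n_Re_Cexp w z (S k)).
  - rewrite (is_derive_n_unique _ _ _ _ (is_derive_n_Re_Cexp w z (S N) zeta)) in E.
    rewrite Cmult_1_l, Rminus_0_r, pow1 in E.
    replace (Re (w * (Cexp z - Cexp_partial N z)))
      with (1 / INR (fact (S N)) * Re (w * z ^ S N * Cexp (zeta * z)))%R.
    + rewrite Rabs_mult.
      assert (Hf := INR_fact_lt_0 (S N)).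
      assert (H1 : (Rabs (Re (w * z ^ S N * Cexp (zeta * z)))
                   <= Cmod w * Cmod z ^ S N * exp (Cmod z))%R).
      { eapply Rle_trans; [apply re_le_Cmod|].
        rewrite !Cmod_mult, Cmod_pow, Cmod_Cexp.
        apply Rmult_le_compat_l.
        - apply Rmult_le_pos; [apply Cmod_ge_0 | apply pow_le, Cmod_ge_0].
        - assert (H2 : (Re (zeta * z) <= Cmod z)%R).
          { eapply Rle_trans; [apply Rle_abs|]; eapply Rle_trans; [apply re_le_Cmod|].
            rewrite Cmod_mult, Cmod_R, Rabs_pos_eq by lra.
            pose proof (Cmod_ge_0 z); nra. }
          destruct H2 as [H2|H2]; [left; now apply exp_increasing | right; now rewrite H2]. }
      rewrite Rabs_pos_eq by (apply Rlt_le, Rdiv_lt_0_compat; lra).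
      replace (Cmod w * (Cmod z ^ S N / INR (fact (S N)) * exp (Cmod z)))%R
        with (1 / INR (fact (S N)) * (Cmod w * Cmod z ^ S N * exp (Cmod z)))%R
        by (field; lra).
      apply Rmult_le_compat_l; auto; apply Rlt_le, Rdiv_lt_0_compat; lra.
    + replace (w * (Cexp z - Cexp_partial N z))
        with (w * Cexp z + - (1) * (w * Cexp_partial N z)) by ring.
      transitivity (Re (w * Cexp z) - Re (w * Cexp_partial N z))%R; [|simpl; ring].
      rewrite E.
      unfold Cexp_partial; rewrite <- sum_n_C_mult_l, Re_sum_n.
      rewrite <- sum_n_Reals.
      match goal with |- _ = (sum_n ?f N + _ - sum_n ?g N)%R => 
        rewrite (sum_n_ext f g) end; [ring|].
      (* The derivative of order [k] at 0 is [Re (w * z ^ k)], so the Taylor polynomial is the real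
         part of [w * Cexp_partial N z]. *)
      intros k; rewrite pow1, (is_derive_n_unique _ _ _ _ (is_derive_n_Re_Cexp w z k 0)).
      replace (0 * z) with (RtoC 0) by ring; rewrite Cexp_0.
      unfold NtoC; pose proof (INR_fact_neq_0 k) as Hk.
      unfold Cdiv; rewrite <- RtoC_inv, Cmult_1_r, Cmult_assoc by auto.
      destruct (w * z ^ k) as [u v]; simpl; field; auto.
Qed.

Lemma Cmod_le_Re_Im (z : C) : (Cmod z <= Rabs (Re z) + Rabs (Im z))%R.
Proof.
  assert (E : z = RtoC (Re z) + Ci * RtoC (Im z))
    by (destruct z; apply injective_projections; simpl; ring).
  rewrite E at 1; eapply Rle_trans; [apply Cmod_triangle|].
  rewrite Cmod_mult, Cmod_Ci, !Cmod_R; lra.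
Qed.

(** The factor 2 comes from adding the bounds for the real and imaginary parts. The bound depends on
    [z] only through [K], which gives uniformity over a bounded family. *)
Lemma Cexp_Taylor (z : C) (N : nat) (K : R) :
  (Cmod z <= K)%R ->
  (Cmod (Cexp z - Cexp_partial N z) <= 2 * exp K * (K ^ S N / INR (fact (S N))))%R.
Proof.
  intros HK.
  assert (Hb : (Cmod z ^ S N / INR (fact (S N)) * exp (Cmod z)
               <= exp K * (K ^ S N / INR (fact (S N))))%R).
  { assert (Hf := INR_fact_lt_0 (S N)).
    rewrite Rmult_comm; apply Rmult_le_compat.
    - left; apply exp_pos.
    - apply Rmult_le_pos; [apply pow_le, Cmod_ge_0 | left; now apply Rinv_0_lt_compat].
    - destruct HK as [HK|HK]; [left; now apply exp_increasing | right; now rewrite HK].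
    - apply Rmult_le_compat_r; [left; now apply Rinv_0_lt_compat|].
      apply pow_incr; split; [apply Cmod_ge_0 | auto]. }
  eapply Rle_trans; [apply Cmod_le_Re_Im|].
  pose proof (Re_Cexp_Taylor 1 z N) as H1.
  pose proof (Re_Cexp_Taylor (- Ci) z N) as H2.
  rewrite Cmod_1, Cmult_1_l in H1.
  rewrite <- Im_as_Re, Cmod_opp, Cmod_Ci in H2.
  lra.
Qed.

(** * Interchange of the two sums in an exponential generating function *)

(** A partial sum over [n] is the series over [m] with each exponential cut to its Taylor
    polynomial. As [u] is bounded, the remainders are small uniformly in [m], and the absolutely
    summable [c] keeps their weighted sum small. *)
Lemma exp_genfun_exchange (c u e : nat -> C) (K : R) (t : C) :
  ex_series (fun m => Cmod (c m)) ->
  (forall m, (Cmod (u m) <= K)%R) ->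
  (forall n, is_series (fun m => c m * u m ^ n) (e n)) ->
  exists s : C,
    is_series (fun m => c m * Cexp (u m * t)) s /\
    is_series (fun n => e n * (t ^ n / NtoC (fact n))) s.
Proof.
  intros [T HT] Hu He.
  set (L := (K * Cmod t)%R).
  assert (Hut : forall m, (Cmod (u m * t) <= L)%R).
  { intros m; rewrite Cmod_mult; apply Rmult_le_compat_r; [apply Cmod_ge_0 | apply Hu]. }
  destruct (ex_series_C_le (fun m => c m * Cexp (u m * t))
              (fun m => exp L * Cmod (c m))%R) as [s Hs].
  { intros m; rewrite Cmod_mult, Cmod_Cexp, Rmult_comm.
    apply Rmult_le_compat_r; [apply Cmod_ge_0|].
    assert (H : (Re (u m * t) <= L)%R).
    { eapply Rle_trans; [apply Rle_abs|]; eapply Rle_trans; [apply re_le_Cmod | apply Hut]. }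
    destruct H as [H|H]; [left; now apply exp_increasing | right; now rewrite H]. }
  { exists (exp L * T)%R; exact (is_series_scal (V := R_NormedModule) (exp L) _ T HT). }
  exists s; split; [exact Hs|].
  (* [rho (S N)] is the remainder bound of [Cexp_Taylor] with [K := L]. *)
  set (rho := fun N => (2 * exp L * (L ^ N / INR (fact N)))%R).
  assert (Hd : forall N, (Cmod (sum_n (fun n => e n * (t ^ n / NtoC (fact n))) N - s)%C
                          <= rho (S N) * T)%R).
  { intros N; set (sN := sum_n _ N).
    (* Only a finite sum over [n] is exchanged with the series over [m] here, so linearity
       suffices. *)
    assert (HN : is_series (fun m => c m * Cexp_partial N (u m * t)) sN).
    { apply is_series_ext with
        (fun m => sum_n (fun n => t ^ n / NtoC (fact n) * (c m * u m ^ n)) N).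
      - intros m; unfold Cexp_partial; rewrite <- sum_n_C_mult_l.
        apply sum_n_ext; intros n; rewrite Cpow_mult_l; unfold Cdiv.
        ring_C.
      - replace sN with (sum_n (fun n => t ^ n / NtoC (fact n) * e n) N : C).
        + apply is_series_C_sum_n; intros i _; apply is_series_C_scal, He.
        + apply sum_n_ext; intros n; apply Cmult_comm. }
    apply (is_series_C_le
             (fun m => c m * Cexp_partial N (u m * t) + - (1) * (c m * Cexp (u m * t)))
             (fun m => rho (S N) * Cmod (c m))%R).
    - intros m.
      replace (c m * Cexp_partial N (u m * t) + - (1) * (c m * Cexp (u m * t)))
        with (- (c m * (Cexp (u m * t) - Cexp_partial N (u m * t)))) by ring.
      rewrite Cmod_opp, Cmod_mult, Rmult_comm.
      apply Rmult_le_compat_r; [apply Cmod_ge_0 | apply Cexp_Taylor, Hut].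
    - replace (sN - s) with (sN + - (1) * s) by ring.
      apply is_series_C_plus; [exact HN | apply is_series_C_scal, Hs].
    - exact (is_series_scal (V := R_NormedModule) (rho (S N)) _ T HT). }
  assert (Hrho : is_lim_seq (fun N => rho (S N) * T)%R 0%R).
  { apply (is_lim_seq_incr_1 (fun N => rho N * T)%R).
    apply is_lim_seq_ext with (fun N => 2 * exp L * T * (L ^ N / INR (fact N)))%R.
    - intros N; unfold rho; ring.
    - replace (Finite 0) with (Rbar_mult (2 * exp L * T)%R 0%R)
        by (simpl; now rewrite Rmult_0_r).
      apply is_lim_seq_scal_l, is_lim_seq_Reals, cv_speed_pow_fact. }
  apply is_series_Cmod; intros eps Heps.
  apply is_lim_seq_Reals in Hrho; destruct (Hrho eps Heps) as [N HN].
  exists N; intros n Hn; eapply Rle_lt_trans; [apply Hd|].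
  specialize (HN n Hn); unfold Rdist in HN; rewrite Rminus_0_r in HN.
  eapply Rle_lt_trans; [apply Rle_abs | exact HN].
Qed.

(** * The series formula for the q-Euler polynomials *)

Lemma qnum_shift (p mu y : C) (m : nat) :
  Cexp mu = p -> qnum p mu (NtoC m + y) = (1 - p ^ m * Cexp (mu * y)) / (1 - p).
Proof.
  intros <-; unfold qnum; do 2 f_equal.
  replace (mu * (NtoC m + y)) with (NtoC m * mu + mu * y) by ring.
  now rewrite Cexp_plus, Cexp_NtoC_mult.
Qed.

Lemma pow_le_1 (x : R) (m : nat) : (0 <= x <= 1)%R -> (x ^ m <= 1)%R.
Proof. intros Hx; rewrite <- (pow1 m); now apply pow_incr. Qed.

(** Supplies the bound independent of [m] that [exp_genfun_exchange] asks for; it rests on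
    [|p ^ m| <= 1]. *)
Lemma Cmod_qnum_shift_le (p mu y : C) (m : nat) :
  Cexp mu = p -> (Cmod p < 1)%R ->
  (Cmod (qnum p mu (NtoC m + y)) <= (1 + Cmod (Cexp (mu * y))) / Cmod (1 - p))%R.
Proof.
  intros Hmu Hp; pose proof (C1_minus_neq_0 p Hp) as Hp1.
  rewrite (qnum_shift p mu y m Hmu), Cmod_div by auto.
  apply Rmult_le_compat_r; [left; now apply Rinv_0_lt_compat, Cmod_gt_0|].
  eapply Rle_trans; [apply Cmod_triangle|].
  rewrite Cmod_1, Cmod_opp, Cmod_mult, Cmod_pow.
  pose proof (Cmod_ge_0 (Cexp (mu * y))).
  pose proof (pow_le_1 (Cmod p) m ltac:(split; [apply Cmod_ge_0 | lra])).
  nra.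
Qed.

Lemma Cmod_sign_mult_pow (p : C) (m : nat) : Cmod (RtoC (-1) ^ m * p ^ m) = (Cmod p ^ m)%R.
Proof.
  rewrite <- Cpow_mult_l, Cmod_pow, Cmod_mult, Cmod_R, Rabs_left by lra.
  f_equal; ring.
Qed.

Lemma ex_series_Cmod_sign_pow (p : C) :
  (Cmod p < 1)%R -> ex_series (fun m => Cmod (RtoC (-1) ^ m * p ^ m)).
Proof.
  intros Hp; apply ex_series_ext with (fun m => Cmod p ^ m)%R.
  - intros m; symmetry; apply Cmod_sign_mult_pow.
  - apply ex_series_geom; now rewrite Rabs_pos_eq by apply Cmod_ge_0.
Qed.

(* The two series defining [qEuler] may be interchanged because the [q]-numbers
   [m + y] are bounded in [m]; comparing coefficients of [t] gives this formula. *)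
Lemma qEuler_series (p mu y : C) (n : nat) :
  Cexp mu = p -> (Cmod p < 1)%R ->
  exists e : C,
    is_series (fun m => RtoC (-1) ^ m * p ^ m * qnum p mu (NtoC m + y) ^ n) e /\
    qEuler p mu n y = qnum p mu 2 * e.
Proof.
  intros Hmu Hp.
  set (K := ((1 + Cmod (Cexp (mu * y))) / Cmod (1 - p))%R).
  assert (HU : forall m, (Cmod (qnum p mu (NtoC m + y)) <= K)%R)
    by (intros m; now apply Cmod_qnum_shift_le).
  assert (He : forall k, exists e : C,
            is_series (fun m => RtoC (-1) ^ m * p ^ m * qnum p mu (NtoC m + y) ^ k) e).
  { intros k; apply ex_series_C_le with (fun m => K ^ k * Cmod (RtoC (-1) ^ m * p ^ m))%R.
    - intros m; rewrite Cmod_mult, Rmult_comm, Cmod_pow.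
      apply Rmult_le_compat_r; [apply Cmod_ge_0|].
      apply pow_incr; split; [apply Cmod_ge_0 | apply HU].
    - apply (ex_series_scal (V := R_NormedModule) (K ^ k)%R), ex_series_Cmod_sign_pow, Hp. }
  set (e := fun k => proj1_sig (constructive_indefinite_description _ (He k))).
  assert (Hek : forall k,
            is_series (fun m => RtoC (-1) ^ m * p ^ m * qnum p mu (NtoC m + y) ^ k) (e k))
    by (intros k; exact (proj2_sig (constructive_indefinite_description _ (He k)))).
  assert (Hgen : qEuler_genfun p mu y (fun k => qnum p mu 2 * e k)).
  { intros t.
    destruct (exp_genfun_exchange (fun m => RtoC (-1) ^ m * p ^ m)
                (fun m => qnum p mu (NtoC m + y)) e K t
                (ex_series_Cmod_sign_pow p Hp) HU Hek) as [s [H1 H2]].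
    exists s; split; [exact H1|].
    apply is_series_ext with (2 := is_series_C_scal (qnum p mu 2) _ _ H2).
    intros k; apply Cmult_assoc. }
  exists (e n); split; [apply Hek|].
  (* [Hgen] shows that a suitable sequence exists, so the one selected by [epsilon] satisfies the
     same property, and uniqueness of coefficients identifies the two. *)
  assert (Heps : qEuler_genfun p mu y (fun k => qEuler p mu k y)).
  { unfold qEuler.
    exact (epsilon_spec (inhabits (fun _ : nat => RtoC 0)) (qEuler_genfun p mu y)
             (ex_intro _ _ Hgen)). }
  apply (C_pseries_unique (fun k => qEuler p mu k y) (fun k => qnum p mu 2 * e k)).
  intros t; destruct (Hgen t) as [s [H1 H2]], (Heps t) as [s' [H1' H2']].
  rewrite (is_series_C_unique _ _ _ H1' H1) in H2'; eauto.
Qed.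

(** * Binomial theorem and alternating geometric sums *)

Lemma binomial_C (x y : C) (n : nat) :
  (x + y) ^ n = sum_n (fun i => RtoC (Binomial.C n i) * x ^ (n - i) * y ^ i) n.
Proof.
  induction n as [|n IH].
  - rewrite sum_n_C_O, C_n_0; simpl; ring.
  - set (f := fun i => RtoC (Binomial.C n i) * x ^ (n - i) * y ^ i).
    assert (Hx : forall i, (i <= n)%nat -> x ^ (S n - i) = x * x ^ (n - i)).
    { intros i Hi; rewrite <- Cpow_S; f_equal; lia. }
    (* By Pascal's rule a truncated row [S n] is [x + y] times the truncated row [n], minus the
       boundary term [y * f k]. At [k = n] that term cancels the last summand of the full row. *)
    assert (Hk : forall k, (k < S n)%nat ->
      sum_n (fun i => RtoC (Binomial.C (S n) i) * x ^ (S n - i) * y ^ i) k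
      = (x + y) * sum_n f k - y * f k :> C).
    { induction k as [|k IHk]; intros Hkn.
      - rewrite !sum_n_C_O; unfold f; rewrite !C_n_0, Hx by lia; simpl; ring.
      - rewrite !sum_n_C_S, IHk by lia; unfold f.
        rewrite <- pascal, RtoC_plus, Hx, Cpow_S by lia.
        replace (n - k)%nat with (S (n - S k))%nat by lia.
        rewrite !Cpow_S; ring. }
    rewrite sum_n_C_S, Hk, Cpow_S, IH by lia.
    unfold f; rewrite !C_n_n, !Nat.sub_diag, Cpow_S; simpl; ring.
Qed.

(** This is a geometric sum of ratio [- r] with [k] terms; oddness of [k] turns [1 - (- r) ^ k] into
    [1 + r ^ k]. The induction adds two terms at a time to keep the parity. *)
Lemma sum_n_alternating_geom (r : C) (k : nat) :
  1 + r <> 0 -> Nat.modulo k 2 = 1%nat ->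
  sum_n (fun j => RtoC (-1) ^ j * r ^ j) (k - 1) = (1 + r ^ k) / (1 + r) :> C.
Proof.
  intros Hr Hk.
  assert (H : forall i, sum_n (fun j => RtoC (-1) ^ j * r ^ j) (2 * i)
                        = (1 + r ^ (2 * i + 1)) / (1 + r) :> C).
  { induction i as [|i IH].
    - rewrite sum_n_C_O; simpl; field; auto.
    - replace (2 * S i)%nat with (S (S (2 * i))) by lia.
      rewrite !sum_n_C_S, IH.
      replace (S (S (2 * i)) + 1)%nat with (S (S (2 * i + 1))) by lia.
      replace (S (S (2 * i))) with (S (2 * i + 1)) by lia.
      replace (S (2 * i)) with (2 * i + 1)%nat by lia.
      rewrite !Cpow_S.
      assert (E : RtoC (-1) ^ (2 * i + 1) = RtoC (-1)).
      { rewrite <- RtoC_pow; f_equal.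
        replace (2 * i + 1)%nat with (S (2 * i)) by lia; apply pow_1_odd. }
      rewrite E; field; auto. }
  pose proof (Nat.div_mod k 2 ltac:(lia)) as D.
  replace k with (2 * (k / 2) + 1)%nat at 2 by lia.
  rewrite <- H; f_equal; lia.
Qed.

(** * Symmetry of the alternating double sum *)

(** The inner sum is finite and is kept inside the term of index [m], so the double sum becomes an
    ordinary series. For [a > 0] the inner sum has [a] terms. *)
Definition alternating_block (F : nat -> C) (a b m : nat) : C :=
  RtoC (-1) ^ m * sum_n (fun j => RtoC (-1) ^ j * F (a * m + b * j)%nat) (a - 1).

Lemma Cmod_pow_lt_1 (r : C) (k : nat) : (Cmod r < 1)%R -> (0 < k)%nat -> (Cmod (r ^ k) < 1)%R.
Proof.
  intros Hr Hk; rewrite Cmod_pow; destruct k as [|k]; [lia|].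
  pose proof (pow_le_1 (Cmod r) k ltac:(split; [apply Cmod_ge_0 | lra])).
  pose proof (Cmod_ge_0 r); simpl; nra.
Qed.

Lemma C1_plus_neq_0 (p : C) : (Cmod p < 1)%R -> 1 + p <> 0.
Proof.
  intros Hp; replace (1 + p) with (1 - - p) by ring.
  apply C1_minus_neq_0; now rewrite Cmod_opp.
Qed.

(** For [F k = r ^ k] the block factors: the sum over [j] is an alternating geometric sum in [r ^ b]
    with an odd number [a] of terms, and the sum over [m] is geometric of ratio [- r ^ a]. *)
Lemma is_series_alternating_block_pow (r : C) (a b : nat) :
  (Cmod r < 1)%R -> (0 < a)%nat -> (0 < b)%nat -> Nat.modulo a 2 = 1%nat ->
  is_series (alternating_block (fun k => r ^ k) a b)
    ((1 + r ^ (a * b)) / ((1 + r ^ a) * (1 + r ^ b))).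
Proof.
  intros Hr Ha Hb Ha2.
  pose proof (Cmod_pow_lt_1 r a Hr Ha) as Hra; pose proof (Cmod_pow_lt_1 r b Hr Hb) as Hrb.
  pose proof (C1_plus_neq_0 _ Hra); pose proof (C1_plus_neq_0 _ Hrb).
  replace ((1 + r ^ (a * b)) / ((1 + r ^ a) * (1 + r ^ b)))
    with ((1 + r ^ (a * b)) / (1 + r ^ b) * / (1 - - r ^ a)) by (field; auto).
  assert (Hg : (Cmod (- r ^ a) < 1)%R) by now rewrite Cmod_opp.
  apply is_series_ext with (2 := is_series_C_scal _ _ _ (is_series_C_geom _ Hg)).
  intros m; unfold alternating_block.
  rewrite Nat.mul_comm, Cpow_mult_r, <- sum_n_alternating_geom by auto.
  rewrite (sum_n_ext (fun j => RtoC (-1) ^ j * r ^ (a * m + b * j))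
             (fun j => (r ^ a) ^ m * (RtoC (-1) ^ j * (r ^ b) ^ j))).
  - rewrite sum_n_C_mult_l.
    replace (- r ^ a) with (RtoC (-1) * r ^ a) by ring.
    rewrite Cpow_mult_l; ring_C.
  - intros j; rewrite Cpow_add_r, !Cpow_mult_r.
    ring_C.
Qed.

(* Induction on [n] generalizing [r]: one factor [u + v q^k] splits the sequence into
   [u] times the one for [r] and [v] times the one for [r q]. *)
Lemma alternating_block_symmetry (q r u v : C) (n a b : nat) :
  (Cmod q < 1)%R -> (Cmod r < 1)%R -> (0 < a)%nat -> (0 < b)%nat ->
  Nat.modulo a 2 = 1%nat -> Nat.modulo b 2 = 1%nat ->
  exists L : C,
    is_series (alternating_block (fun k => r ^ k * (u + v * q ^ k) ^ n) a b) L /\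
    is_series (alternating_block (fun k => r ^ k * (u + v * q ^ k) ^ n) b a) L.
Proof.
  intros Hq Hr Ha Hb Ha2 Hb2; revert r Hr; induction n as [|n IH]; intros r Hr.
  - exists ((1 + r ^ (a * b)) / ((1 + r ^ a) * (1 + r ^ b))); split.
    + apply is_series_ext with (2 := is_series_alternating_block_pow r a b Hr Ha Hb Ha2).
      intros m; unfold alternating_block; f_equal; apply sum_n_ext; intros j; simpl.
      now rewrite Cmult_1_r.
    (* The closed form is symmetric in [a] and [b]; the swapped series takes the same value because
       [b] is odd as well. *)
    + rewrite Nat.mul_comm, (Cmult_comm (1 + r ^ a)).
      apply is_series_ext with (2 := is_series_alternating_block_pow r b a Hr Hb Ha Hb2).
      intros m; unfold alternating_block; f_equal; apply sum_n_ext; intros j; simpl.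
      now rewrite Cmult_1_r.
  - destruct (IH r Hr) as [L1 [H1 H1']].
    destruct (IH (r * q)) as [L2 [H2 H2']].
    { rewrite Cmod_mult; pose proof (Cmod_ge_0 r); pose proof (Cmod_ge_0 q); nra. }
    assert (Hlin : forall a b m,
      u * alternating_block (fun k => r ^ k * (u + v * q ^ k) ^ n) a b m
      + v * alternating_block (fun k => (r * q) ^ k * (u + v * q ^ k) ^ n) a b m
      = alternating_block (fun k => r ^ k * (u + v * q ^ k) ^ S n) a b m).
    { intros a' b' m; unfold alternating_block.
      match goal with |- u * (?s * sum_n ?f ?k) + v * (?s * sum_n ?g ?k) = _ =>
        transitivity (s * sum_n (fun j => u * f j + v * g j) k) end.
      - rewrite sum_n_C_plus, !sum_n_C_mult_l; ring.
      - f_equal; apply sum_n_ext; intros j; rewrite Cpow_S, Cpow_mult_l.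
        ring_C. }
    exists (u * L1 + v * L2); split.
    + apply is_series_ext with (1 := Hlin a b).
      apply is_series_C_plus; now apply is_series_C_scal.
    + apply is_series_ext with (1 := Hlin b a).
      apply is_series_C_plus; now apply is_series_C_scal.
Qed.

(** * Each side as an alternating double sum *)

Lemma Cexp_NtoC_base (lam q : C) (a : nat) : Cexp lam = q -> Cexp (NtoC a * lam) = q ^ a.
Proof. intros <-; apply Cexp_NtoC_mult. Qed.

Lemma qnum_NtoC (p mu : C) (k : nat) : Cexp mu = p -> qnum p mu (NtoC k) = (1 - p ^ k) / (1 - p).
Proof.
  intros <-; unfold qnum; do 2 f_equal; now rewrite Cmult_comm, Cexp_NtoC_mult.
Qed.

(** Treats one side of the identity, the other being the same with [a] and [b] exchanged. The base
    of the [n]-th power is [[k + abx]_q], written as [u + v * q ^ k] to match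
    [alternating_block_symmetry]. *)
Lemma qEuler_Sstar_sum (lam q x : C) (n a b : nat) :
  Cexp lam = q -> (Cmod q < 1)%R -> (0 < a)%nat -> (0 < b)%nat ->
  exists L : C,
    is_series (alternating_block
      (fun k => q ^ k * (/ (1 - q) + - Cexp (NtoC a * NtoC b * lam * x) / (1 - q) * q ^ k) ^ n)
      a b) L /\
    sum_n (fun i : nat =>
      RtoC (Binomial.C n i)
      * qnum q lam (NtoC a) ^ (n - i) * qnum q lam (NtoC b) ^ i
      * qEuler (q ^ a) (NtoC a * lam) (n - i) (NtoC b * x)
      * Sstar (q ^ b) (NtoC b * lam) n i a) n
    = qnum (q ^ a) (NtoC a * lam) 2 * L :> C.
Proof.
  intros Hlam Hq Ha Hb.
  pose proof (Cexp_NtoC_base lam q a Hlam) as Hla.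
  pose proof (Cexp_NtoC_base lam q b Hlam) as Hlb.
  pose proof (Cmod_pow_lt_1 q a Hq Ha) as Hqa; pose proof (Cmod_pow_lt_1 q b Hq Hb) as Hqb.
  pose proof (C1_minus_neq_0 _ Hq) as Hq1.
  pose proof (C1_minus_neq_0 _ Hqa) as Hqa1; pose proof (C1_minus_neq_0 _ Hqb) as Hqb1.
  set (U := fun m => qnum (q ^ a) (NtoC a * lam) (NtoC m + NtoC b * x)).
  assert (He : forall k, exists e : C,
    is_series (fun m => RtoC (-1) ^ m * (q ^ a) ^ m * U m ^ k) e /\
    qEuler (q ^ a) (NtoC a * lam) k (NtoC b * x) = qnum (q ^ a) (NtoC a * lam) 2 * e)
    by (intros k; now apply qEuler_series).
  set (e := fun k => proj1_sig (constructive_indefinite_description _ (He k))).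
  assert (Hek : forall k, is_series (fun m => RtoC (-1) ^ m * (q ^ a) ^ m * U m ^ k) (e k) /\
    qEuler (q ^ a) (NtoC a * lam) k (NtoC b * x) = qnum (q ^ a) (NtoC a * lam) 2 * e k)
    by (intros k; exact (proj2_sig (constructive_indefinite_description _ (He k)))).
  set (w := fun i => RtoC (Binomial.C n i)
      * qnum q lam (NtoC a) ^ (n - i) * qnum q lam (NtoC b) ^ i
      * Sstar (q ^ b) (NtoC b * lam) n i a).
  exists (sum_n (fun i => w i * e (n - i)%nat) n); split.
  - apply is_series_ext with
      (fun m => sum_n (fun i => w i * (RtoC (-1) ^ m * (q ^ a) ^ m * U m ^ (n - i))) n).
    + intros m; unfold alternating_block, w, Sstar.
      set (P := Cexp (NtoC a * NtoC b * lam * x)).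
      assert (HU : qnum q lam (NtoC a) * U m = (1 - q ^ (a * m) * P) / (1 - q)).
      { unfold U; rewrite qnum_NtoC, qnum_shift by auto.
        replace (NtoC a * lam * (NtoC b * x)) with (NtoC a * NtoC b * lam * x) by ring.
        fold P; rewrite Cpow_mult_r; field; auto. }
      assert (HV : forall j, qnum q lam (NtoC b) * qnum (q ^ b) (NtoC b * lam) (NtoC j)
                             = (1 - q ^ (b * j)) / (1 - q)).
      { intros j; rewrite !qnum_NtoC by auto; rewrite Cpow_mult_r; field; auto. }
      (* The weight [q^(bj(n+1-i))] of [Sstar] is split: one factor [q^(bj)] joins [q^(am)], the
         others scale [[am+abx]_q]. The binomial theorem then applies through [q^(bj) [am+abx]_q +
         [bj]_q = [am+bj+abx]_q]. *)
      transitivity (sum_n (fun i => sum_n (fun j =>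
        RtoC (-1) ^ m * (RtoC (-1) ^ j * q ^ (a * m + b * j)) *
        (RtoC (Binomial.C n i) *
         (q ^ (b * j) * (qnum q lam (NtoC a) * U m)) ^ (n - i) *
         (qnum q lam (NtoC b) * qnum (q ^ b) (NtoC b * lam) (NtoC j)) ^ i)) (a - 1)) n : C).
      * apply sum_n_ext_loc; intros i Hi.
        match goal with |- ?c * sum_n ?f ?k * ?d = _ =>
          transitivity (sum_n (fun j => c * d * f j) k : C);
          [rewrite sum_n_C_mult_l; ring_C|] end.
        apply sum_n_ext; intros j.
        (* Truncated subtraction makes this depend on [i <= n], which [sum_n_ext_loc] provides. *)
        replace (n + 1 - i)%nat with (S (n - i)) by lia.
        rewrite (Nat.mul_comm (S _)), !Cpow_mult_l, !Cpow_add_r, !Cpow_mult_r, Cpow_S.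
        ring_C.
      * rewrite sum_n_switch, <- sum_n_C_mult_l; apply sum_n_ext; intros j.
        rewrite sum_n_C_mult_l, <- binomial_C, HU, HV.
        rewrite <- !Cmult_assoc; do 4 f_equal.
        rewrite Cpow_add_r; field; auto.
    + apply is_series_C_sum_n; intros i _; apply is_series_C_scal, Hek.
  - rewrite <- sum_n_C_mult_l; apply sum_n_ext; intros i.
    rewrite (proj2 (Hek (n - i)%nat)); unfold w; ring_C.
Qed.

Theorem theorem2p4 (lam q : C) (Hlam : Cexp lam = q)
    (Hq : (0 < Cmod q < 1)%R)
    (n a b : nat) (Ha : (0 < a)%nat) (Hb : (0 < b)%nat)
    (Ha2 : Nat.modulo a 2 = 1%nat) (Hb2 : Nat.modulo b 2 = 1%nat)
    (x : C) :
  qnum (q ^ b) (NtoC b * lam) 2 *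
    sum_n (fun i : nat =>
      RtoC (Binomial.C n i)
      * qnum q lam (NtoC a) ^ (n - i) * qnum q lam (NtoC b) ^ i
      * qEuler (q ^ a) (NtoC a * lam) (n - i) (NtoC b * x)
      * Sstar (q ^ b) (NtoC b * lam) n i a) n
  =
  qnum (q ^ a) (NtoC a * lam) 2 *
    sum_n (fun i : nat =>
      RtoC (Binomial.C n i)
      * qnum q lam (NtoC b) ^ (n - i) * qnum q lam (NtoC a) ^ i
      * qEuler (q ^ b) (NtoC b * lam) (n - i) (NtoC a * x)
      * Sstar (q ^ a) (NtoC a * lam) n i b) n.
Proof.
  destruct Hq as [_ Hq].
  destruct (qEuler_Sstar_sum lam q x n a b Hlam Hq Ha Hb) as [L1 [H1 ->]].
  destruct (qEuler_Sstar_sum lam q x n b a Hlam Hq Hb Ha) as [L2 [H2 ->]].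
  (* Aligns the exponent [abx] in the two series, so that both are blocks of the same sequence. *)
  rewrite (Cmult_comm (NtoC b) (NtoC a)) in H2.
  (* Taking [r := q] accounts for the factor [q ^ k]. Both sides then equal [[2]_{q^a} [2]_{q^b}
     L]. *)
  destruct (alternating_block_symmetry q q (/ (1 - q))
    (- Cexp (NtoC a * NtoC b * lam * x) / (1 - q)) n a b Hq Hq Ha Hb Ha2 Hb2)
    as [L [HL1 HL2]].
  rewrite (is_series_C_unique _ _ _ H1 HL1), (is_series_C_unique _ _ _ H2 HL2); ring.
Qed.
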